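(* Let $i$ be an agent with finite nonempty action set $\mathcal A_i$, finite observation space $\mathcal O_i$ and logits $\theta^i(o,a)\in\mathbb R$ ($o\in\mathcal O_i$, $a\in\mathcal A_i$), with tabular softmax policy $\pi^i(a\mid o)=\exp(\theta^i(o,a))/\sum_{b\in\mathcal A_i}\exp(\theta^i(o,b))$. Let $o_{i,t}\in\mathcal O_i$ be the current observation, $\widehat g_{i,\cdot,t}=(\widehat g_{i,a,t})_{a\in\mathcal A_i}\in\mathbb R^{\mathcal A_i}$ and $\eta>0$. Then the KL-mirror update $$\pi^{i,+}(\cdot\mid o_{i,t})\in\arg\max_{p\in\mathcal F_i}\Big\{\eta\langle\widehat g_{i,\cdot,t},p\rangle-D_{\mathrm{KL}}\big(p\Vert\pi^i(\cdot\mid o_{i,t})\big)\Big\}$$ is given by $$\pi^{i,+}(a\mid o_{i,t})=\frac{\pi^i(a\mid o_{i,t})\exp(\eta\widehat g_{i,a,t})}{\sum_{b\in\mathcal A_i}\pi^i(b\mid o_{i,t})\exp(\eta\widehat g_{i,b,t})},\qquad a\in\mathcal A_i,$$ and, with $\pi^{i,+}(\cdot\mid o)=\pi^i(\cdot\mid o)$ for all $o\in\mathcal O_i\setminus\{o_{i,t}\}$, it coincides exactly with the softmax policy of the additively updated logits $\theta^{i,+}(o_{i,t},a)=\theta^i(o_{i,t},a)+\eta\widehat g_{i,a,t}$ ($a\in\mathcal A_i$), $\theta^{i,+}(o,a)=\theta^i(o,a)$ for $o\in\mathcal O_i\setminus\{o_{i,t}\}$, $a\in\mathcal A_i$.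
   Context: $\mathcal F_i=\{p\in[0,1]^{\mathcal A_i}:\sum_{a\in\mathcal A_i}p_a=1\}$ is the probability simplex over $\mathcal A_i$. $D_{\mathrm{KL}}(p\Vert q)=\sum_{a\in\mathcal A_i}p_a\log(p_a/q_a)$ with the convention $0\log(0/q_a)=0$. $\langle\cdot,\cdot\rangle$ is the Euclidean inner product. *)

(* Defs.v *)
From mathcomp Require Import all_boot all_order all_algebra.
From mathcomp Require Import all_classical all_reals all_analysis.

Set Implicit Arguments.
Unset Strict Implicit.
Unset Printing Implicit Defensive.

Import Order.TTheory GRing.Theory Num.Theory.

Local Open Scope classical_set_scope.
Local Open Scope ring_scope.

Definition simplex (R : realType) (A : finType) : set (A -> R) :=
  [set p | (forall a, 0 <= p a <= 1) /\ \sum_a p a = 1].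
Arguments simplex : clear implicits.

Definition inner (R : realType) (A : finType) (u v : A -> R) : R :=
  \sum_a u a * v a.

(* The test implements the convention 0 log (0 / q) = 0. The value is the
   Kullback-Leibler divergence only when p vanishes wherever q does (otherwise
   the divergence is infinite); softmax policies q are everywhere positive. *)
Definition KL (R : realType) (A : finType) (p q : A -> R) : R :=
  \sum_a (if p a == 0 then 0 else p a * ln (p a / q a)).

Definition argmax (R : realType) (T : Type) (F : set T) (J : T -> R) : set T :=
  [set p | F p /\ forall q, F q -> J q <= J p].

Definition softmax (R : realType) (O A : finType) (theta : O -> A -> R)
    (o : O) (a : A) : R :=
  expR (theta o a) / \sum_b expR (theta o b).

Definition kl_objective (R : realType) (A : finType) (eta : R) (g q p : A -> R)
    : R :=
  eta * inner g p - KL p q.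

Definition kl_mirror_update (R : realType) (O A : finType) (pol : O -> A -> R)
    (ot : O) (g : A -> R) (eta : R) (pol' : O -> A -> R) : Prop :=
  argmax (simplex R A) (kl_objective eta g (pol ot)) (pol' ot) /\
  (forall o, o != ot -> forall a, pol' o a = pol o a).

Definition logit_update (R : realType) (O A : finType) (theta : O -> A -> R)
    (ot : O) (g : A -> R) (eta : R) (o : O) (a : A) : R :=
  if o == ot then theta o a + eta * g a else theta o a.

(* Main.v *)
Require Import Defs.
From mathcomp Require Import all_boot all_order all_algebra.
From mathcomp Require Import all_classical all_reals all_analysis.
From mathcomp Require Import ring lra.

Set Implicit Arguments.
Unset Strict Implicit.
Unset Printing Implicit Defensive.

Import Order.TTheory GRing.Theory Num.Theory.

Local Open Scope classical_set_scope.
Local Open Scope ring_scope.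

(** For a positive [q], the tilted distribution [r a = q a * expR (eta * g a) / Z]
    satisfies the Gibbs variational identity
    [kl_objective eta g q p = ln Z - KL p r] on the simplex. Since [KL p r >= 0]
    with equality only at [p = r], [r] is the unique maximizer. The normalizing
    constant of [softmax theta] cancels in [r], which is therefore the softmax of
    the shifted logits. *)

(** For [p > 0] this is [1 + x < expR x] at [x = ln (r / p)], multiplied by [p]; [x] is nonzero
    because [p != r]. The bound [p - r] is useful because it sums to zero over two distributions. *)
Lemma KL_term_gt (R : realType) (p r : R) : 0 <= p -> 0 < r -> p != r ->
  p - r < (if p == 0 then 0 else p * ln (p / r)).
Proof.
move=> p0 r0 pr; case: eqVneq => [->|pn0]; first by rewrite sub0r oppr_lt0.
have {p0}pp : 0 < p by rewrite lt_neqAle eq_sym pn0.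
have rp0 : 0 < r / p by rewrite divr_gt0.
have -> : p / r = (r / p)^-1 by rewrite invf_div.
rewrite lnV ?posrE//.
have yn0 : ln (r / p) != 0.
  apply: contra pr => /eqP y0; have := lnK rp0; rewrite y0 expR0 => rp1.
  by rewrite eq_sym -[r](divfK pn0) -rp1 mul1r.
have := expR_gt1Dx yn0; rewrite lnK ?posrE// ltr_pdivlMr// => H.
lra.
Qed.

Lemma KL_term_ge (R : realType) (p r : R) : 0 <= p -> 0 < r ->
  p - r <= (if p == 0 then 0 else p * ln (p / r)).
Proof.
move=> p0 r0; have [->|pr] := eqVneq p r; last exact/ltW/KL_term_gt.
by rewrite gt_eqF// divff ?gt_eqF// ln1 mulr0 subrr.
Qed.

Section Gibbs.
Variables (R : realType) (A : finType).
Implicit Types p q r g : A -> R.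

Lemma KLpp r : KL r r = 0.
Proof.
rewrite /KL big1// => a _; case: eqVneq => // ra0.
by rewrite divff// ln1 mulr0.
Qed.

Lemma KL_ge0 p r : simplex R A p -> simplex R A r -> (forall a, 0 < r a) ->
  0 <= KL p r.
Proof.
(* Both masses are 1, so [0] becomes the sum of [p a - r a] and the comparison is termwise. *)
move=> [p01 p1] [_ r1] r0; rewrite -[0](subrr 1) -{1}p1 -r1 -sumrB.
by apply: ler_sum => a _; apply: KL_term_ge => //; case/andP: (p01 a).
Qed.

Lemma KL_le0_eq p r : simplex R A p -> simplex R A r -> (forall a, 0 < r a) ->
  KL p r <= 0 -> p =1 r.
Proof.
(* By contraposition: a single coordinate with [p a != r a] contributes a strict inequality, and the
   others contribute weak ones, so the divergence is positive. *)
move=> [p01 p1] [_ r1] r0 KL0 a; apply/eqP; apply: contraTT KL0 => pra.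
have p0 b : 0 <= p b by case/andP: (p01 b).
rewrite -ltNge -[0](subrr 1) -{1}p1 -r1 -sumrB /KL.
rewrite (bigD1 a)//= [ltRHS](bigD1 a)//=.
by apply: ltr_leD; [exact: KL_term_gt | apply: ler_sum => b _; exact: KL_term_ge].
Qed.

Lemma simplex_normalize (w : A -> R) : (0 < #|A|)%N -> (forall a, 0 < w a) ->
  [/\ 0 < \sum_b w b, forall a, 0 < w a / \sum_b w b &
      simplex R A (fun a => w a / \sum_b w b)].
Proof.
move=> /card_gt0P[a0 _] w0.
have Z0 : 0 < \sum_b w b.
  by rewrite (bigD1 a0)//= ltr_pwDl// sumr_ge0// => b _; exact: ltW.
split=> // [a|]; first by rewrite divr_gt0.
split=> [a|]; last by rewrite -mulr_suml divff// gt_eqF.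
rewrite divr_ge0 ?(ltW Z0) ?(ltW (w0 a))//= ler_pdivrMr// mul1r.
by rewrite (bigD1 a)//= lerDl sumr_ge0// => b _; exact: ltW.
Qed.

Definition tilt eta g q (a : A) : R :=
  q a * expR (eta * g a) / \sum_b q b * expR (eta * g b).

Lemma kl_objective_tilt eta g q p : (0 < #|A|)%N -> (forall a, 0 < q a) ->
  simplex R A p ->
  kl_objective eta g q p =
    ln (\sum_b q b * expR (eta * g b)) - KL p (tilt eta g q).
Proof.
move=> A0 q0 [p01 p1].
have w0 a : 0 < q a * expR (eta * g a) by rewrite mulr_gt0 ?expR_gt0.
have [Z0 _ _] := simplex_normalize A0 w0.
rewrite /kl_objective /inner /KL.
(* Writing [ln Z] as the sum of [p a * ln Z] reduces the identity to one term per action. *)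
rewrite -[ln _]mul1r -{1}p1 mulr_sumr mulr_suml -!sumrB; apply: eq_bigr => a _.
case: eqVneq => [->|pn0]; first by rewrite mulr0 mul0r mulr0.
have pa0 : 0 < p a by rewrite lt_neqAle eq_sym pn0; case/andP: (p01 a).
(* The logarithm of the tilt at [a] is [ln (q a) + eta * g a - ln Z], so the remaining identity is
   linear in the logarithms. *)
rewrite /tilt !ln_div ?posrE ?divr_gt0//.
rewrite lnM ?posrE ?expR_gt0// expRK; ring.
Qed.

Lemma argmax_kl_objective eta g q p : (0 < #|A|)%N -> (forall a, 0 < q a) ->
  argmax (simplex R A) (kl_objective eta g q) p <-> p =1 tilt eta g q.
Proof.
move=> A0 q0.
have w0 a : 0 < q a * expR (eta * g a) by rewrite mulr_gt0 ?expR_gt0.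
have [_ r0 rS] := simplex_normalize A0 w0.
(* Tested against the tilt, whose objective value is [ln Z], optimality of [p] says that its
   divergence from the tilt is at most 0. *)
split=> [[pS /(_ _ rS)]|/funext ->].
  rewrite !kl_objective_tilt// KLpp lerD2l lerN2; exact: KL_le0_eq.
split=> // p' p'S.
by rewrite !kl_objective_tilt// KLpp lerD2l lerN2; exact: KL_ge0.
Qed.

End Gibbs.

Section Softmax.
Variables (R : realType) (O A : finType) (theta : O -> A -> R) (ot : O).
Variables (g : A -> R) (eta : R).
Hypothesis A0 : (0 < #|A|)%N.

Lemma softmax_gt0 o a : 0 < softmax theta o a.
Proof.
have [_ H _] := simplex_normalize A0 (fun b => expR_gt0 (theta o b)).
exact: H.
Qed.

Lemma tilt_softmax :
  tilt eta g (softmax theta ot) =1 softmax (logit_update theta ot g eta) ot.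
Proof.
move=> a; rewrite /tilt /softmax /logit_update eqxx.
have [Z0 _ _] := simplex_normalize A0 (fun b => expR_gt0 (theta ot b)).
set Z := \sum_b expR (theta ot b) in Z0 *.
(* The factor [Z^-1] is pulled out of the denominator so that it cancels the one in the
   numerator. *)
have -> : \sum_b expR (theta ot b) / Z * expR (eta * g b) =
            Z^-1 * \sum_b expR (theta ot b + eta * g b).
  by rewrite mulr_sumr; apply: eq_bigr => c _; rewrite expRD mulrAC mulrC.
by rewrite [_ / Z * _]mulrAC -expRD [_ / Z]mulrC -mulf_div divff ?mul1r// invr_eq0 gt_eqF.
Qed.

Lemma softmax_logit_update_neq o : o != ot ->
  softmax (logit_update theta ot g eta) o =1 softmax theta o.
Proof. by move=> oot a; rewrite /softmax /logit_update (negPf oot). Qed.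

End Softmax.

Theorem mainTheorem6 (R : realType) (A O : finType) (hA : (0 < #|A|)%N)
    (theta : O -> A -> R) (ot : O) (g : A -> R) (eta : R) (heta : 0 < eta) :
  (forall p : A -> R,
     argmax (simplex R A) (kl_objective eta g (softmax theta ot)) p <->
     forall a, p a = softmax theta ot a * expR (eta * g a) /
                     \sum_b softmax theta ot b * expR (eta * g b)) /\
  (forall pol' : O -> A -> R,
     kl_mirror_update (softmax theta) ot g eta pol' <->
     forall o a, pol' o a = softmax (logit_update theta ot g eta) o a).
Proof.
have argmaxE p := argmax_kl_objective eta g p hA (softmax_gt0 theta hA ot).
split=> [|pol']; first exact: argmaxE.
(* Both directions split on the observation: [ot] is governed by the unique maximizer, and elsewhere
   both policies equal the old one. *)
split=> [[/argmaxE polt polo] o a|polE].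
  have [->|oot] := eqVneq o ot; first by rewrite polt tilt_softmax.
  by rewrite polo// softmax_logit_update_neq.
split=> [|o oot a]; last by rewrite polE softmax_logit_update_neq.
by apply/argmaxE => a; rewrite polE tilt_softmax.
Qed.
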